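(* Let $p>3$ be a prime and let $t\in\mathbb{Z}_p$ with $3t\not\equiv \pm 5\pmod p$. Then $$\sum_{k=0}^{(p-1)/2}\binom{2k}k^2\binom{4k}{2k}\Big(\frac{1-t^2}{256}\Big)^k \equiv \Big(\frac{10+6t}p\Big)\sum_{k=0}^{\lfloor p/6\rfloor}\binom{2k}k\binom{3k}k\binom{6k}{3k}\Big(\frac{(t-1)^2(t+1)} {64(3t+5)^3}\Big)^k \equiv \Big(\frac{10-6t}p\Big)\sum_{k=0}^{\lfloor p/6\rfloor}\binom{2k}k\binom{3k}k\binom{6k}{3k}\Big(\frac{(t+1)^2(t-1)} {64(3t-5)^3}\Big)^k \pmod p.$$
   Context: For a prime $p$, $\mathbb{Z}_p$ denotes the set of rational numbers whose denominator is not divisible by $p$; congruences modulo $p$ are taken in $\mathbb{Z}_p$. For $a\in\mathbb{Z}_p$, $\big(\frac ap\big)$ is the Legendre symbol of $a$ (i.e. of any integer congruent to $a$ modulo $p$). $\lfloor x\rfloor$ is the greatest integer not exceeding $x$. *)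

(* Defs.v *)
From mathcomp Require Import all_boot all_order all_algebra.

Set Implicit Arguments.
Unset Strict Implicit.
Unset Printing Implicit Defensive.

Import Order.TTheory GRing.Theory Num.Theory.
Local Open Scope ring_scope.

Definition Zloc (p : nat) : {pred rat} := [pred x | ~~ (p %| denq x)%Z].

Definition eqmodZloc (p : nat) (x y : rat) : bool :=
  [&& x \in Zloc p, y \in Zloc p & (x - y) / p%:R \in Zloc p].

Definition legendre (p : nat) (n : int) : int :=
  if (p %| n)%Z then 0
  else if [exists x : 'I_p, (x%:Z ^+ 2 == n %[mod p])%Z] then 1 else -1.

(* The residue r is unique when p is prime and a \in Zloc p; legendre_locE
   below shows that any integer congruent to a gives the same value. *)
Definition legendre_loc (p : nat) (a : rat) : int :=
  if [pick r : 'I_p | eqmodZloc p a (r : nat)%:R] is Some r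
  then legendre p (r : nat)%:Z else 0.

Lemma Zloc_intro (p : nat) (x : rat) (d m : int) :
  ~~ (p %| d)%Z -> x * d%:~R = m%:~R -> x \in Zloc p.
Proof.
move=> pd xd; rewrite inE; apply: contra pd => pden.
suff /(dvdz_trans pden) : (denq x %| d)%Z by [].
rewrite -(@Gauss_dvdzr _ (numq x)); last by rewrite coprimez_sym; apply: coprime_num_den.
apply/dvdzP; exists m; apply: (@intr_inj rat).
by rewrite !rmorphM /= numqE -xd mulrAC.
Qed.

Lemma Zloc_int (p : nat) (n : int) : prime p -> n%:~R \in Zloc p.
Proof.
move=> pp; apply: (@Zloc_intro _ _ 1 n); last by rewrite mulr1.
by rewrite dvdz1 absz_nat; case: p pp => [|[]].
Qed.

Lemma ZlocB (p : nat) (x y : rat) :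
  prime p -> x \in Zloc p -> y \in Zloc p -> x - y \in Zloc p.
Proof.
move=> pp xp yp.
apply: (@Zloc_intro _ _ (denq x * denq y) (numq x * denq y - numq y * denq x)).
  by rewrite dvdzE abszM Euclid_dvdM // negb_or -!dvdzE; apply/andP; split.
rewrite rmorphB !rmorphM /= !numqE mulrBl mulrA; congr (_ - _).
by rewrite [(denq x)%:~R * _]mulrC mulrA.
Qed.

Lemma eqmodZloc_int (p : nat) (m n : int) :
  prime p -> eqmodZloc p m%:~R n%:~R = (m == n %[mod p])%Z.
Proof.
move=> pp; rewrite /eqmodZloc !Zloc_int //= eqz_mod_dvd -rmorphB /=.
have p0 : p%:R != 0 :> rat by rewrite pnatr_eq0 -lt0n prime_gt0.
apply/idP/dvdzP => [xp|[q ->]]; last first.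
  by rewrite rmorphM /= -pmulrn mulfK // Zloc_int.
set x := _ / _ in xp; have xE : x * p%:R = (m - n)%:~R by rewrite divfK.
have nxE : (numq x * p = (m - n) * denq x)%R.
  by apply: (@intr_inj rat); rewrite !rmorphM /= numqE -xE -pmulrn mulrAC.
have : (p %| (m - n) * denq x)%Z by rewrite -nxE dvdz_mull.
rewrite dvdzE abszM Euclid_dvdM // -!dvdzE => /orP[/dvdzP //|pd].
by rewrite inE pd in xp.
Qed.

Lemma legendre_mod (p : nat) (m n : int) :
  (m = n %[mod p])%Z -> legendre p m = legendre p n.
Proof.
move=> mn; rewrite /legendre.
have -> : (p %| m)%Z = (p %| n)%Z by apply/dvdz_mod0P/dvdz_mod0P; rewrite mn.
by under eq_existsb => x do rewrite mn.
Qed.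

Lemma legendre_locE (p : nat) (a : rat) (n : int) :
  prime p -> eqmodZloc p a n%:~R -> legendre_loc p a = legendre p n.
Proof.
move=> pp /and3P[ap _ anp].
have aE (r : nat) : eqmodZloc p a r%:R = (n == r%:Z %[mod p])%Z.
  rewrite -(eqmodZloc_int _ _ pp) /eqmodZloc ap (Zloc_int _ pp) /= -pmulrn.
  rewrite (Zloc_int r%:Z pp) /=; apply/idP/idP => h.
    have := ZlocB pp h anp; rewrite -mulrBl opprB [a - _ + _]addrC.
    by rewrite addrA subrK.
  have := ZlocB pp anp (ZlocB pp (Zloc_int 0 pp) h).
  by rewrite sub0r opprK -mulrDl addrA subrK.
rewrite /legendre_loc; case: pickP => [r|none].
  by rewrite aE => /eqP nr; apply/esym/legendre_mod.
have p0 : p%:Z != 0 by rewrite -lt0n prime_gt0.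
have rE : (`|(n %% p)%Z|%N%:Z = n %% p)%Z by rewrite gez0_abs // modz_ge0.
have rp : (`|(n %% p)%Z|%N < p)%N.
  by rewrite -ltz_nat rE ltz_pmod // ltz_nat prime_gt0.
by have := none (Ordinal rp); rewrite aE /= rE modz_mod eqxx.
Qed.

(* Main.v *)
(* Put s = t - 1 and e = (p - 1) / 2, and work with polynomials in s over F_p.
   The first sum is a polynomial G(s) in s (s + 2); since p divides 2 e + 1, its
   coefficients satisfy the recurrence of 3F2(1/4, 1/2, 3/4; 1, 1) with no
   boundary term.  Likewise (3 s + 8)^e times the second sum is a polynomial
   H(s), and its coefficients terminate the recurrence of 3F2(1/6, 1/2, 5/6; 1, 1)
   because p = 6 k + 1 or 6 k + 5; here e stands for the exponent -1/2.
   As in the classical cubic transformation, G and H are both killed by the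
   symmetric square of a Legendre operator.  At s = 0 its local exponents are
   0, 0, 0, so a solution of degree < p is determined by its constant term:
   G = 2^e H, as 2^e 8^e = 4^(p - 1) = 1.  Euler's criterion turns
   (2 (3 t + 5))^e into the Legendre symbol, and t -> - t, which fixes the first
   sum, exchanges the other two. *)
Require Import Defs.
From mathcomp Require Import all_boot all_order all_algebra.
From mathcomp Require Import ring zify.
From mathcomp Require Import finfield.

Set Implicit Arguments.
Unset Strict Implicit.
Unset Printing Implicit Defensive.

Import Order.TTheory GRing.Theory Num.Theory.
Local Open Scope ring_scope.

(** * Multinomial coefficients of the sums and their recurrences *)

Definition coef4 (k : nat) : nat := 'C(2 * k, k) ^ 2 * 'C(4 * k, 2 * k).
Definition coef6 (k : nat) : nat := 'C(2 * k, k) * 'C(3 * k, k) * 'C(6 * k, 3 * k).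

Lemma bin_fact_sub (n m r : nat) :
  n = (m + r)%N -> ('C(n, m) * (m`! * r`!) = n`!)%N.
Proof. by move=> ->; rewrite -{2}(addKn m r) bin_fact ?leq_addr. Qed.

Lemma coef4_fact (k : nat) : (coef4 k * k`! ^ 4 = (4 * k)`!)%N.
Proof.
rewrite /coef4 -(@bin_fact_sub (4 * k) (2 * k) (2 * k)); last by lia.
rewrite -(@bin_fact_sub (2 * k) k k); last by lia.
by ring.
Qed.

Lemma coef6_fact (k : nat) : (coef6 k * (k`! ^ 3 * (3 * k)`!) = (6 * k)`!)%N.
Proof.
rewrite /coef6 -(@bin_fact_sub (6 * k) (3 * k) (3 * k)); last by lia.
rewrite -(@bin_fact_sub (3 * k) k (2 * k)); last by lia.
rewrite -(@bin_fact_sub (2 * k) k k); last by lia.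
by ring.
Qed.

(** As [coef4 k] is (4 k)! / k!^4, of the four new factors of (4 k + 4)!, 4 k + 4 cancels one k + 1
    and 4 k + 2 is 2 (2 k + 1); hence the 8. This is the term ratio of 3F2(1/4, 1/2, 3/4; 1, 1) at
    argument 256 x. *)
Lemma coef4S (k : nat) :
  (k.+1 ^ 3 * coef4 k.+1 = 8 * ((4 * k + 1) * (2 * k + 1) * (4 * k + 3)) * coef4 k)%N.
Proof.
have /eqP := coef4_fact k.+1.
rewrite (_ : 4 * k.+1 = (4 * k).+4)%N; last by lia.
rewrite !factS -coef4_fact => /eqP E.
apply/eqP; rewrite -(@eqn_pmul2r (k.+1 * k`! ^ 4)) ?muln_gt0 ?expn_gt0 ?fact_gt0 //.
apply/eqP; transitivity (coef4 k.+1 * (k.+1 * k`!) ^ 4)%N; first by ring.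
by rewrite E; ring.
Qed.

(** Here 6 k + 2, 6 k + 4 and 6 k + 6 are twice the new factors of (3 k + 3)!, and 6 k + 3 is 3 (2 k
    + 1); hence the 24. *)
Lemma coef6S (k : nat) :
  (k.+1 ^ 3 * coef6 k.+1 = 24 * ((6 * k + 1) * (2 * k + 1) * (6 * k + 5)) * coef6 k)%N.
Proof.
have /eqP := coef6_fact k.+1.
rewrite (_ : 6 * k.+1 = (6 * k).+4.+2)%N; last by lia.
rewrite (_ : 3 * k.+1 = (3 * k).+3)%N; last by lia.
rewrite !factS -coef6_fact => /eqP E.
apply/eqP; rewrite -(@eqn_pmul2r ((3 * k).+3 * (3 * k).+2 * (3 * k).+1 * (k`! ^ 3 * (3 * k)`!)))
  ?muln_gt0 ?expn_gt0 ?fact_gt0 //.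
apply/eqP.
transitivity (coef6 k.+1 * ((k.+1 * k`!) ^ 3 * ((3 * k).+3 * ((3 * k).+2 * ((3 * k).+1 * (3 * k)`!)))))%N.
  by ring.
by rewrite E; ring.
Qed.

(** * The Euler derivation, the operator [sqleg], and its action on the terms of both sums *)

Section Operator.
Variable F : fieldType.
Implicit Types f W R : {poly F}.

(* Locked, so that thetaM does not apply to theta f seen as 'X * f^`(). *)
Definition theta f : {poly F} := locked ('X * f^`()).

Lemma theta_def f : theta f = 'X * f^`().
Proof. by rewrite /theta -lock. Qed.

Lemma thetaM f g : theta (f * g) = theta f * g + f * theta g.
Proof. by rewrite !theta_def derivM; ring. Qed.

Lemma thetaD f g : theta (f + g) = theta f + theta g.
Proof. by rewrite !theta_def derivD mulrDr. Qed.

Lemma thetaX : theta 'X = 'X.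
Proof. by rewrite !theta_def derivX mulr1. Qed.

Lemma theta_nat n : theta n%:R = 0.
Proof. by rewrite theta_def -[n%:R]/(1 *+ n) derivMn derivC mul0rn mulr0. Qed.

(** The extra factor f avoids the power n - 1, so the formula also covers n = 0. *)
Lemma theta_exp f n : f * theta (f ^+ n) = n%:R * theta f * f ^+ n.
Proof.
case: n => [|n]; first by rewrite expr0 (theta_nat 1) mulr0 !mul0r.
by rewrite !theta_def deriv_exp /= exprS -mulr_natl; ring.
Qed.

Lemma coef_theta f n : (theta f)`_n = n%:R * f`_n.
Proof.
rewrite theta_def mulrC coefMX; case: n => [|n]; first by rewrite mul0r.
by rewrite coef_deriv /= mulr_natl.
Qed.

(* Up to a polynomial factor, the symmetric square of the Legendre equation
   ((1 - t^2) y')' = 3/16 y, in the variable 'X = t - 1. *)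
Definition sqleg f : {poly F} :=
  4 * ('X + 2) ^+ 2 * theta (theta (theta f)) + 12 * 'X * ('X + 2) * theta (theta f)
  + ('X * (14 + 11 * 'X)) * theta f + 3 * 'X * (1 + 'X) * f.

Lemma sqlegD f g : sqleg (f + g) = sqleg f + sqleg g.
Proof. by rewrite /sqleg !thetaD; ring. Qed.

Lemma thetaZ a f : theta (a *: f) = a *: theta f.
Proof. by rewrite !theta_def derivZ scalerAr. Qed.

Lemma sqlegZ a f : sqleg (a *: f) = a *: sqleg f.
Proof. by rewrite /sqleg !thetaZ !scalerDr !scalerAr. Qed.

Lemma sqleg_sum (n : nat) (a : nat -> F) (T : nat -> {poly F}) :
  sqleg (\sum_(k < n) a k *: T k) = \sum_(k < n) a k *: sqleg (T k).
Proof.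
elim: n => [|n IH]; last by rewrite !big_ord_recr /= sqlegD sqlegZ IH.
by rewrite !big_ord0; have := sqlegZ 0 0; rewrite !scale0r.
Qed.

(* If theta f = (R / W) f, then sqleg f is a rational multiple of f. *)
Lemma sqleg_log W R Q W1 Q1 f :
    W * theta f = R * f -> theta W = W1 ->
    Q = W * theta R + R ^+ 2 - R * W1 -> theta Q = Q1 ->
  W ^+ 3 * sqleg f =
    (4 * ('X + 2) ^+ 2 * (W * Q1 + Q * R - 2 * Q * W1)
     + 12 * 'X * ('X + 2) * W * Q
     + ('X * (14 + 11 * 'X)) * W ^+ 2 * R + 3 * 'X * (1 + 'X) * W ^+ 3) * f.
Proof.
move=> E1 <- QE <-.
(* Applying theta to W theta f = R f and multiplying by W gives theta^2 f = (Q / W^2) f; the same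
   step repeated gives theta^3 f. *)
have E2 : W ^+ 2 * theta (theta f) = Q * f.
  have := congr1 (fun g => W * theta g) E1; rewrite !thetaM => /eqP.
  rewrite !mulrDr => /eqP E.
  transitivity (W * (theta W * theta f) + W * (W * theta (theta f)) - theta W * (W * theta f)).
    by ring.
  rewrite E E1 QE.
  transitivity (W * (theta R * f) + R * (W * theta f) - theta W * (R * f)); first by ring.
  by rewrite E1; ring.
have E3 : W ^+ 3 * theta (theta (theta f)) = (W * theta Q + Q * R - 2 * Q * theta W) * f.
  have := congr1 (fun g => W * theta g) E2; rewrite expr2 !thetaM => E.
  transitivity (W * ((theta W * W + W * theta W) * theta (theta f) + W * W * theta (theta (theta f)))
     - 2 * theta W * (W ^+ 2 * theta (theta f))); first by ring.
  rewrite E E2.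
  transitivity (W * theta Q * f + Q * (W * theta f) - 2 * theta W * (Q * f)); first by ring.
  by rewrite E1; ring.
transitivity (4 * ('X + 2) ^+ 2 * (W ^+ 3 * theta (theta (theta f)))
   + 12 * 'X * ('X + 2) * W * (W ^+ 2 * theta (theta f))
   + ('X * (14 + 11 * 'X)) * W ^+ 2 * (W * theta f) + 3 * 'X * (1 + 'X) * W ^+ 3 * f).
  by rewrite /sqleg; ring.
by rewrite E3 E2 E1; ring.
Qed.

Lemma theta0 : theta 0 = 0.
Proof. exact: (theta_nat 0). Qed.

Lemma theta1 : theta 1 = 0.
Proof. exact: (theta_nat 1). Qed.

Lemma thetaN f : theta (- f) = - theta f.
Proof. by rewrite !theta_def derivN mulrN. Qed.

Lemma X_neq0 : 'X != 0 :> {poly F}.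
Proof. by rewrite -size_poly_eq0 size_polyX. Qed.

Lemma thetaCX c n : theta c = 0 -> theta (c * 'X^n) = n%:R * c * 'X^n.
Proof.
move=> c0; apply: (mulfI X_neq0); rewrite thetaM c0 mul0r add0r mulrCA theta_exp thetaX.
by ring.
Qed.

Let thetaE := (expr2, thetaD, thetaN, thetaM, thetaX, theta_nat, theta0, theta1).

Lemma X_add2_neq0 : 'X + 2 != 0 :> {poly F}.
Proof. by rewrite -[2](rmorph_nat polyC) -size_poly_eq0 size_XaddC. Qed.

(** Only V and the next power 'X ('X + 2) V occur, so suitably weighted sums telescope: in the
    variable z = 'X ('X + 2), [sqleg] is a multiple of a hypergeometric operator. *)
Lemma sqleg_quadratic_exp k (V := ('X * ('X + 2)) ^+ k : {poly F}) :
  ('X + 2) * sqleg V =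
  ('X + 1) * (32 * k%:R ^+ 3
    + (4 * k%:R + 1) * (2 * k%:R + 1) * (4 * k%:R + 3) * ('X * ('X + 2))) * V.
Proof.
have E : ('X + 2) * theta V = (k%:R * (2 * 'X + 2)) * V.
  apply: (mulfI X_neq0); rewrite mulrA /V theta_exp !thetaE.
  by ring.
have EW : theta ('X + 2) = 'X :> {poly F} by rewrite !thetaE; ring.
pose Q : {poly F} := 2 * k%:R * 'X + 4 * k%:R * k%:R * (('X + 1) * ('X + 1)).
have EQ : Q = ('X + 2) * theta (k%:R * (2 * 'X + 2)) + (k%:R * (2 * 'X + 2)) ^+ 2
    - k%:R * (2 * 'X + 2) * 'X.
  by rewrite /Q !thetaE; ring.
have EQ1 : theta Q = 2 * k%:R * 'X + 8 * k%:R * k%:R * 'X * ('X + 1).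
  by rewrite /Q !thetaE; ring.
have E' := sqleg_log E EW EQ EQ1.
(* [sqleg_log] carries ('X + 2)^3, two factors more than the claim. *)
apply: (mulfI (expf_neq0 2 X_add2_neq0)).
transitivity (('X + 2) ^+ 3 * sqleg V); first by ring.
by rewrite E' /Q; ring.
Qed.

(* With e in the role of -1/2: (3 'X + 8)^e ('X^2 ('X + 2) / (3 'X + 8)^3)^k, for 3 k <= e. *)
Definition cubic_term (e k : nat) : {poly F} :=
  'X ^+ (2 * k) * ('X + 2) ^+ k * (3 * 'X + 8) ^+ (e - 3 * k).

(** As long as 3 (k + 1) <= e, 'X^2 ('X + 2) T is (3 'X + 8)^3 times the next term, so two
    consecutive terms occur here too. Putting -1/2 for e makes the coefficients depend on k only. *)
Lemma sqleg_cubic_term (e k : nat) (T := cubic_term e k) :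
    2 * e%:R + 1 = 0 :> {poly F} ->
    2 != 0 :> {poly F} -> (3 * k <= e)%N ->
  ('X + 2) * (3 * 'X + 8) ^+ 3 * sqleg T =
  2 * (9 * 'X + 16) * (8 * k%:R ^+ 3 * (3 * 'X + 8) ^+ 3
    - 3 * ((6 * k%:R + 1) * (2 * k%:R + 1) * (6 * k%:R + 5)) * ('X ^+ 2 * ('X + 2))) * T.
Proof.
move=> e_half nz2 ke.
(* The common denominator of theta T / T, doubled to absorb the 1/2 in e = -1/2; R below is W theta
   T / T. *)
pose W : {poly F} := 2 * ('X + 2) * (3 * 'X + 8).
have eE : 2 * (e - 3 * k)%:R = - (1 + 6 * k%:R) :> {poly F}.
  rewrite natrB // natrM; apply/eqP; rewrite -subr_eq0.
  by rewrite -[X in _ == X]e_half; apply/eqP; ring.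
pose R : {poly F} := 4 * k%:R * ('X + 2) * (3 * 'X + 8)
  + 2 * k%:R * 'X * (3 * 'X + 8) - 3 * (1 + 6 * k%:R) * 'X * ('X + 2).
have E : W * theta T = R * T.
  rewrite /T /cubic_term exprM !thetaM.
  set A := ('X ^+ 2) ^+ k; set B := _ ^+ k; set C := _ ^+ (e - _).
  have EA : theta A = 2 * k%:R * A.
    apply: (mulfI (expf_neq0 2 X_neq0)).
    by rewrite theta_exp -/A !thetaE; ring.
  have EB : ('X + 2) * theta B = k%:R * 'X * B.
    by rewrite theta_exp -/B !thetaE; ring.
  have EC : 2 * ((3 * 'X + 8) * theta C) = - (1 + 6 * k%:R) * (3 * 'X) * C.
    by rewrite theta_exp -/C !thetaE -eE; ring.
  transitivity (W * theta A * B * C + 2 * (3 * 'X + 8) * A * C * (('X + 2) * theta B)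
     + A * B * ('X + 2) * (2 * ((3 * 'X + 8) * theta C))); first by rewrite /W; ring.
  by rewrite EA EB EC /W /R; ring.
have EW : theta W = 12 * 'X * 'X + 28 * 'X by rewrite /W !thetaE; ring.
(* Coefficients of Q expanded in powers of 'X, a form in which theta Q is read off termwise. *)
pose c3 : {poly F} := - (12 + 432 * k%:R).
pose c2 : {poly F} := 1296 * (k%:R * k%:R) - 1584 * k%:R - 156.
pose c1 : {poly F} := 4608 * (k%:R * k%:R) - 1408 * k%:R - 192.
pose Q : {poly F} := 9 * 'X^4 + c3 * 'X^3 + c2 * 'X^2 + c1 * 'X^1 + 4096 * k%:R * k%:R.
have ER : theta R = 36 * k%:R * 'X - 6 * 'X * 'X - 6 * 'X by rewrite /R !thetaE; ring.
have EQ : Q = W * theta R + R ^+ 2 - R * (12 * 'X * 'X + 28 * 'X).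
  by rewrite ER /Q /W /R /c1 /c2 /c3; ring.
have EQ1 : theta Q = 36 * 'X^4 + 3 * c3 * 'X^3 + 2 * c2 * 'X^2 + c1 * 'X.
  have K2 : theta (k%:R * k%:R) = 0 by rewrite -natrM theta_nat.
  have K0 (n : nat) (c : {poly F}) : theta c = 0 -> theta (n%:R * c) = 0.
    by move=> c0; rewrite thetaM theta_nat c0 mul0r mulr0 addr0.
  have C3 : theta c3 = 0 by rewrite thetaN thetaD (K0 432) ?theta_nat ?add0r ?oppr0.
  have C2 : theta c2 = 0.
    by rewrite !thetaD !thetaN (K0 1296) // (K0 1584) ?theta_nat // !oppr0 !addr0.
  have C1 : theta c1 = 0.
    by rewrite !thetaD !thetaN (K0 4608) // (K0 1408) ?theta_nat // !oppr0 !addr0.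
  have C0 : theta (4096 * k%:R * k%:R) = 0 by rewrite -mulrA (K0 4096).
  rewrite /Q !thetaD C0 (thetaCX 4 (theta_nat 9)) (thetaCX 3 C3) (thetaCX 2 C2) (thetaCX 1 C1).
  by ring.
have E' := sqleg_log E EW EQ EQ1.
have nz : 8 * ('X + 2) ^+ 2 != 0 :> {poly F}.
  by rewrite mulf_neq0 ?expf_neq0 ?X_add2_neq0 // (natrX _ 2 3) expf_neq0.
apply: (mulfI nz).
transitivity (W ^+ 3 * sqleg T); first by rewrite /W; ring.
by rewrite E' /W /R /Q /c1 /c2 /c3; ring.
Qed.
End Operator.

(** * Telescoping, and uniqueness of a solution with given constant term *)

Lemma telescope_sum_eq0 (V : zmodType) (n : nat) (u v : nat -> V) :
    u 0%N = 0 -> v n = 0 -> (forall k, (k < n)%N -> u k.+1 = v k) ->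
  \sum_(k < n.+1) (u k - v k) = 0.
Proof.
move=> u0 vn uv; rewrite sumrB big_ord_recl u0 add0r big_ord_recr /= vn addr0.
by rewrite (eq_bigr (fun i : 'I_n => v i)) ?subrr // => i _; rewrite uv.
Qed.

(** In degree n the equation is 16 n^3 f_n plus multiples of f_(n-1) and f_(n-2). The leading factor
    is invertible for 0 < n < N, so strong induction kills every coefficient once f_0 = 0. *)
Lemma sqleg_inj (F : fieldType) (N : nat) (f : {poly F}) :
    (2 : F) != 0 -> (forall n, (0 < n < N)%N -> n%:R != 0 :> F) ->
    (size f <= N)%N -> sqleg f = 0 -> f`_0 = 0 -> f = 0.
Proof.
move=> nz2 nzN szf Lf f0.
have nz16 : 16 != 0 :> F by rewrite (natrX _ 2 4) expf_neq0.
apply/polyP => n; rewrite coef0.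
elim/ltn_ind: n => n IH; case: (leqP N n) => [Nn|nN].
  by rewrite nth_default // (leq_trans szf).
case: n => [//|n] in IH nN *.
have := congr1 (fun g : {poly F} => g`_n.+1) Lf.
have -> : sqleg f = theta (theta (theta f)) *+ 16
    + 'X * (theta (theta (theta f)) *+ 16 + theta (theta f) *+ 24 + theta f *+ 14 + f *+ 3)
    + 'X * ('X * (theta (theta (theta f)) *+ 4 + theta (theta f) *+ 12 + theta f *+ 11 + f *+ 3)).
  by rewrite /sqleg; ring.
have z (g : {poly F}) m : g`_m = 0 -> (theta g)`_m = 0 by rewrite coef_theta => ->; rewrite mulr0.
have Z m : (m < n.+1)%N -> [/\ f`_m = 0, (theta f)`_m = 0, (theta (theta f))`_m = 0
    & (theta (theta (theta f)))`_m = 0]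
    by move=> /IH fm; split; [exact: fm | exact: z | exact/z/z | exact/z/z/z].
have cXS (g : {poly F}) m : ('X * g)`_m.+1 = g`_m by rewrite coefXM.
have cX0 (g : {poly F}) : ('X * g)`_0 = 0 by rewrite coefXM.
rewrite !(coefMn, coefD, cXS); have [//| -> -> -> ->] := Z n.
have -> : ('X * (theta (theta (theta f)) *+ 4 + theta (theta f) *+ 12 + theta f *+ 11 + f *+ 3))`_n = 0.
  case: n => [|n] in IH nN Z *; rewrite ?cX0 ?cXS // !(coefMn, coefD).
  by have [//| -> -> -> ->] := Z n; rewrite !mul0rn !addr0.
rewrite !mul0rn !addr0 !coef_theta coef0 => /eqP.
rewrite -[_ *+ 16]mulr_natr !mulf_eq0 (negPf nz16) orbF.
by rewrite (negPf (nzN _ _)) //= => /eqP.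
Qed.

(** * Both sums as polynomials over a field of characteristic p *)

Lemma odd_prime_gt3 (p : nat) : prime p -> (3 < p)%N -> odd p.
Proof. by move=> p_prime p_gt3; case: (even_prime p_prime) p_gt3 => // ->. Qed.

Lemma half_pred (p : nat) : prime p -> (3 < p)%N -> (2 * (p.-1 %/ 2) + 1 = p)%N.
Proof. by move=> p_prime p_gt3; have := odd_prime_gt3 p_prime p_gt3; lia. Qed.

Section CharP.
Variables (F : fieldType) (p : nat).
Hypotheses (p_prime : prime p) (p_gt3 : (3 < p)%N) (p_char : p \in [pchar F]).

Lemma natr_eq0_pchar n : (n%:R == 0 :> F) = (p %| n)%N.
Proof. by rewrite (dvdn_pcharf p_char). Qed.

Lemma small_neq0 n : (0 < n < p)%N -> n%:R != 0 :> F.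
Proof. by case/andP=> n0 np; rewrite natr_eq0_pchar gtnNdvd. Qed.

Lemma two_neq0 : 2 != 0 :> F.
Proof. by apply: small_neq0; rewrite /= ltnW. Qed.

Let e := (p.-1 %/ 2)%N.

Let odd_p : odd p := odd_prime_gt3 p_prime p_gt3.
Let half_p : (2 * e + 1 = p)%N := half_pred p_prime p_gt3.

Lemma pchar_half : 2 * e%:R + 1 = 0 :> F.
Proof. by rewrite -natrM natr1 -addn1 half_p pcharf0. Qed.

Lemma natr_polyC n : n%:R = n%:R%:P :> {poly F}.
Proof. by rewrite rmorph_nat. Qed.

Let polyC_morphE := (fun n => esym (natr_polyC n), polyC1, polyC_exp, polyCM, polyCD, polyCN, polyC0).

(** At t - 1 the base 'X ('X + 2) takes the value t^2 - 1, hence the sign in the weight. *)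
Definition quad_sum : {poly F} :=
  \sum_(k < e.+1) ((coef4 k)%:R * (- 256^-1) ^+ k) *: ('X * ('X + 2)) ^+ k.

Definition cubic_sum : {poly F} :=
  \sum_(k < (p %/ 6).+1) ((coef6 k)%:R / 64 ^+ k) *: cubic_term F e k.

(** [coef4S] rescaled to match the two terms of [sqleg_quadratic_exp]: 8 times 32 is 256, which the
    weight turns into -1. *)
Lemma coef4_rec k :
  32 * k.+1%:R ^+ 3 * ((coef4 k.+1)%:R * (- 256^-1) ^+ k.+1) =
  - ((4 * k%:R + 1) * (2 * k%:R + 1) * (4 * k%:R + 3) * ((coef4 k)%:R * (- 256^-1) ^+ k)) :> F.
Proof.
have E : k.+1%:R ^+ 3 * (coef4 k.+1)%:R =
    8 * ((4 * k%:R + 1) * (2 * k%:R + 1) * (4 * k%:R + 3)) * (coef4 k)%:R :> F.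
  by transitivity ((k.+1 ^ 3 * coef4 k.+1)%N%:R : F); [ring | rewrite coef4S; ring].
have nz : 256 != 0 :> F by rewrite (natrX _ 2 8) expf_neq0 ?two_neq0.
set a := - 256^-1; have aE : 256 * a = -1 by rewrite /a; field.
clearbody a; rewrite [a ^+ _]exprS; move: (a ^+ k) => b.
transitivity (32 * a * (k.+1%:R ^+ 3 * (coef4 k.+1)%:R) * b); first by ring.
rewrite E.
transitivity (256 * a * ((4 * k%:R + 1) * (2 * k%:R + 1) * (4 * k%:R + 3))
  * ((coef4 k)%:R * b)); first by ring.
by rewrite aE mulN1r mulNr.
Qed.

Lemma coef6_rec k :
  8 * k.+1%:R ^+ 3 * ((coef6 k.+1)%:R / 64 ^+ k.+1) =
  3 * ((6 * k%:R + 1) * (2 * k%:R + 1) * (6 * k%:R + 5)) * ((coef6 k)%:R / 64 ^+ k) :> F.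
Proof.
have E : k.+1%:R ^+ 3 * (coef6 k.+1)%:R =
    24 * ((6 * k%:R + 1) * (2 * k%:R + 1) * (6 * k%:R + 5)) * (coef6 k)%:R :> F.
  by transitivity ((k.+1 ^ 3 * coef6 k.+1)%N%:R : F); [ring | rewrite coef6S; ring].
have nz : 64 != 0 :> F by rewrite (natrX _ 2 6) expf_neq0 ?two_neq0.
rewrite -!exprVn [_^-1 ^+ k.+1]exprS; set a := 64^-1; have aE : 64 * a = 1 by rewrite /a; field.
clearbody a; move: (a ^+ k) => b.
transitivity (8 * a * (k.+1%:R ^+ 3 * (coef6 k.+1)%:R) * b); first by ring.
rewrite E.
transitivity (64 * a * (3 * ((6 * k%:R + 1) * (2 * k%:R + 1) * (6 * k%:R + 5)))
  * ((coef6 k)%:R * b)); first by ring.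
by rewrite aE mul1r.
Qed.

(** The images telescope: u k carries k^3, which vanishes at k = 0, and u (k + 1) = v k is
    [coef4_rec]. *)
Lemma sqleg_quad_sum : sqleg quad_sum = 0.
Proof.
apply: (mulfI (X_add2_neq0 F)); rewrite mulr0 /quad_sum.
rewrite (sqleg_sum _ (fun k => (coef4 k)%:R * (- 256^-1) ^+ k) (fun k => ('X * ('X + 2)) ^+ k)).
rewrite mulr_sumr.
pose g k : {poly F} := ((coef4 k)%:R * (- 256^-1) ^+ k)%:P.
pose u k : {poly F} := ('X + 1) * ((32 * k%:R ^+ 3 * g k) * ('X * ('X + 2)) ^+ k).
pose v k : {poly F} := ('X + 1) *
  (- ((4 * k%:R + 1) * (2 * k%:R + 1) * (4 * k%:R + 3) * g k) * ('X * ('X + 2)) ^+ k.+1).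
rewrite (eq_bigr (fun k : 'I_e.+1 => u k - v k)) => [|k _].
  apply: telescope_sum_eq0 => [||k _]; first by rewrite /u expr0n /= mulr0 !mul0r mulr0.
    (* The last term v e contains 2 e + 1 = p, which is 0 in F. *)
    rewrite /v -[2](rmorph_nat polyC) -[e%:R](rmorph_nat polyC) -[1](rmorph1 polyC).
    by rewrite -rmorphM -rmorphD /= pchar_half !(mulr0, mul0r, oppr0).
  rewrite /u /v; congr (_ * (_ * _)).
  have := coef4_rec k; rewrite /g.
  move: (_%:R * (- 256^-1) ^+ k.+1) (_%:R * _ ^+ k) => a b /(congr1 polyC).
  by rewrite !polyC_morphE.
rewrite -mul_polyC -/(g k) mulrCA sqleg_quadratic_exp /u /v [_ ^+ k.+1]exprS.
move: (g k) (_ ^+ k) => a b {u v g}.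
by ring.
Qed.

(** Ends the recurrence of [cubic_sum] at its last index: p is prime to 6, so one of the two factors
    is p. *)
Lemma pchar_sixth (k := (p %/ 6)%N) : (6 * k%:R + 1) * (6 * k%:R + 5) = 0 :> F.
Proof.
apply/eqP; rewrite -!natrM natr1 -addn1 -natrD -natrM natr_eq0_pchar Euclid_dvdM //.
have p2 := odd_p.
have p3 : ~~ (3 %| p)%N.
  by rewrite dvdn_prime2 //; apply: contraTneq p_gt3 => <-.
have [<-|<-] : (6 * k + 1 = p)%N \/ (6 * k + 5 = p)%N by rewrite /k; lia.
  by rewrite addn1 dvdnn.
by rewrite dvdnn orbT.
Qed.

Lemma threeX_add8_neq0 : 3 * 'X + 8 != 0 :> {poly F}.
Proof.
have nz8 : 8 != 0 :> F by rewrite (natrX _ 2 3) expf_neq0 ?two_neq0.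
apply: contraNneq nz8 => /(congr1 (fun f : {poly F} => f.[0])).
by rewrite hornerD hornerM hornerX mulr0 add0r natr_polyC hornerC horner0 => ->.
Qed.

Lemma sqleg_cubic_sum : sqleg cubic_sum = 0.
Proof.
have nz : ('X + 2) * (3 * 'X + 8) ^+ 3 != 0 :> {poly F}.
  by rewrite mulf_neq0 ?expf_neq0 ?X_add2_neq0 ?threeX_add8_neq0.
apply: (mulfI nz); rewrite mulr0 /cubic_sum.
rewrite (sqleg_sum _ (fun k => (coef6 k)%:R / 64 ^+ k) (cubic_term F e)).
rewrite mulr_sumr.
(* No exponent e - 3 k in the sum is truncated. *)
have Ke : (3 * (p %/ 6) <= e)%N by have := odd_p; rewrite /e; lia.
set K := (p %/ 6)%N in Ke *.
pose h k : {poly F} := ((coef6 k)%:R / 64 ^+ k)%:P.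
pose u k : {poly F} := 2 * (9 * 'X + 16) *
  (8 * k%:R ^+ 3 * h k * ((3 * 'X + 8) ^+ 3 * cubic_term F e k)).
pose v k : {poly F} := 2 * (9 * 'X + 16) *
  (3 * ((6 * k%:R + 1) * (2 * k%:R + 1) * (6 * k%:R + 5)) * h k
     * ('X ^+ 2 * ('X + 2) * cubic_term F e k)).
rewrite (eq_bigr (fun k : 'I_K.+1 => u k - v k)) => [|k _].
  apply: telescope_sum_eq0 => [||k kK]; first by rewrite /u expr0n /= !(mulr0, mul0r).
    have := congr1 polyC pchar_sixth; rewrite -/K => E.
    have {}E : (6 * K%:R + 1) * (6 * K%:R + 5) = 0 :> {poly F}.
      by rewrite -[RHS]E !polyC_morphE.
    by rewrite /v [_ * (2 * _ + 1)]mulrC -(mulrA (2 * _ + 1)) E !(mulr0, mul0r).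
  rewrite /u /v; congr (_ * (_ * _)).
    have := coef6_rec k; rewrite /h.
    move: (_%:R / 64 ^+ k.+1) (_%:R / 64 ^+ k) => a b /(congr1 polyC).
    by rewrite !polyC_morphE.
  (* Three factors 3 'X + 8 are exchanged for 'X^2 ('X + 2) from one term to the next; k < K ensures
     3 (k + 1) <= e. *)
  rewrite /cubic_term (_ : (e - 3 * k = 3 + (e - 3 * k.+1))%N); last by lia.
  rewrite (_ : (2 * k.+1 = 2 + 2 * k)%N); last by lia.
  by rewrite !exprD [_ ^+ k.+1]exprS; ring.
have e_half : 2 * e%:R + 1 = 0 :> {poly F}.
  by rewrite -[RHS](congr1 polyC pchar_half) !polyC_morphE.
have nz2 : 2 != 0 :> {poly F} by rewrite natr_polyC polyC_eq0 two_neq0.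
have ke : (3 * k <= e)%N by have := ltn_ord k; lia.
rewrite -mul_polyC -/(h k) mulrCA sqleg_cubic_term // /u /v.
move: (h k) (cubic_term _ _ _) => a b {u v h}.
by ring.
Qed.

(** The degree is at most 2 e = p - 1, just within the reach of [sqleg_inj]. *)
Lemma size_quad_sum : (size quad_sum <= p)%N.
Proof.
apply: leq_trans (size_sum _ _ _) _; apply/bigmax_leqP => k _.
apply: leq_trans (size_scale_leq _ _) _; apply: leq_trans (size_poly_exp_leq _ _) _.
have : (size ('X * ('X + 2) : {poly F})%R <= 3)%N.
  apply: leq_trans (size_polyMleq _ _) _.
  by rewrite size_polyX natr_polyC size_XaddC.
move=> sz; rewrite -[leqRHS]half_p addn1 ltnS leq_mul //; last by rewrite -ltnS.
by rewrite -subn1 leq_subLR.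
Qed.

(** Each term has degree at most 2 k + k + (e - 3 k) = e. *)
Lemma size_cubic_sum : (size cubic_sum <= p)%N.
Proof.
apply: leq_trans (size_sum _ _ _) _; apply/bigmax_leqP => k _.
apply: leq_trans (size_scale_leq _ _) _; rewrite /cubic_term.
set A := 'X ^+ _; set B := _ ^+ k; set C := _ ^+ _.
have sA : (size A <= (2 * k).+1)%N by rewrite size_polyXn.
have sB : (size B <= k.+1)%N.
  by apply: leq_trans (size_poly_exp_leq _ _) _; rewrite natr_polyC size_XaddC mul1n.
have sC : (size C <= (e - 3 * k).+1)%N.
  apply: leq_trans (size_poly_exp_leq _ _) _; rewrite ltnS.
  rewrite -{2}(mul1n (_ - _)%N) leq_mul2r -subn1 leq_subLR.
  rewrite !natr_polyC mul_polyC; apply/orP; right.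
  apply: leq_trans (size_polyD _ _) _; rewrite geq_max.
  rewrite (leq_trans (size_scale_leq _ _)) ?size_polyX //.
  by rewrite (leq_trans (size_polyC_leq1 _)).
have sAB := size_polyMleq A B; have sABC := size_polyMleq (A * B) C.
have := half_p; have := ltn_ord k; have := odd_p.
move: sA sB sC sAB sABC; move: (size A) (size B) (size C) (size (A * B)) (size (A * B * C)).
by rewrite /e; lia.
Qed.

Lemma two_eight_exp_half : 2 ^+ e * 8 ^+ e = 1 :> F.
Proof.
have nz4 : 4 != 0 :> F by rewrite (natrX _ 2 2) expf_neq0 ?two_neq0.
(* After multiplication by 4 the claim is 4^p = 4, and Frobenius fixes the image of a natural
   number. *)
apply: (mulfI nz4); rewrite -exprMn -natrM (natrX _ 4 2) -exprM mulr1 -exprS.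
have -> : (2 * e).+1 = p by rewrite -[RHS]half_p addn1.
by rewrite -(pFrobenius_autE p_char) pFrobenius_aut_nat.
Qed.

Lemma quad_sum_eq : quad_sum = 2 ^+ e *: cubic_sum.
Proof.
apply/eqP; rewrite -subr_eq0; apply/eqP/(@sqleg_inj _ p).
- exact: two_neq0.
- exact: small_neq0.
- apply: leq_trans (size_polyD _ _) _; rewrite size_polyN geq_max size_quad_sum.
  exact: leq_trans (size_scale_leq _ _) size_cubic_sum.
- by rewrite -scaleN1r sqlegD !sqlegZ sqleg_quad_sum sqleg_cubic_sum !scaler0 addr0.
(* Only k = 0 survives at 0: the constant terms are 1 and 2^e 8^e. *)
rewrite -horner_coef0 hornerD hornerN hornerZ !horner_sum !big_ord_recl /=.
rewrite !big1 => [|k _|k _]; last 2 first.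
- by rewrite hornerZ /cubic_term !hornerM hornerXn expr0n /= !(mul0r, mulr0).
- by rewrite hornerZ horner_exp hornerM hornerX mul0r expr0n mulr0.
have h8 : (3 * 'X + 8 : {poly F}).[0] = 8.
  by rewrite hornerD hornerM hornerX mulr0 add0r natr_polyC hornerC.
rewrite !hornerZ /cubic_term !muln0 subn0 !expr0 !mul1r horner_exp h8 -polyC1 hornerC.
by rewrite invr1 mul1r !addr0 two_eight_exp_half subrr.
Qed.

(** [quad_sum_eq] evaluated at t - 1; its scalar 2^e and the power (3 t + 5)^e combine into (10 + 6
    t)^e. *)
Lemma quad_cubic_transform (t : F) : 3 * t + 5 != 0 ->
  \sum_(k < e.+1) 'C(2 * k, k)%:R ^+ 2 * 'C(4 * k, 2 * k)%:R * ((1 - t ^+ 2) / 256) ^+ k =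
  (10 + 6 * t) ^+ e * \sum_(k < (p %/ 6).+1)
    'C(2 * k, k)%:R * 'C(3 * k, k)%:R * 'C(6 * k, 3 * k)%:R
      * ((t - 1) ^+ 2 * (t + 1) / (64 * (3 * t + 5) ^+ 3)) ^+ k.
Proof.
move=> nz; have h2 : ('X + 2 : {poly F}).[t - 1] = t + 1.
  by rewrite hornerD hornerX natr_polyC hornerC; ring.
have h8 : (3 * 'X + 8 : {poly F}).[t - 1] = 3 * t + 5.
  by rewrite hornerD hornerM hornerX !natr_polyC !hornerC; ring.
have nz64 : 64 != 0 :> F by rewrite (natrX _ 2 6) expf_neq0 ?two_neq0.
have nz256 : 256 != 0 :> F by rewrite (natrX _ 2 8) expf_neq0 ?two_neq0.
have := congr1 (fun f : {poly F} => f.[t - 1]) quad_sum_eq.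
rewrite hornerZ !horner_sum => E.
transitivity (\sum_(k < e.+1)
    (((coef4 k)%:R * (- 256^-1) ^+ k) *: ('X * ('X + 2)) ^+ k).[t - 1]).
  apply: eq_bigr => k _; rewrite hornerZ horner_exp hornerM hornerX h2.
  rewrite /coef4 natrM natrX -[RHS]mulrA -exprMn; congr (_ * _ ^+ _).
  by field.
rewrite E (_ : 10 + 6 * t = 2 * (3 * t + 5)); last by ring.
rewrite [(2 * _) ^+ e]exprMn -[RHS]mulrA; congr (_ * _).
rewrite mulr_sumr; apply: eq_bigr => k _.
have ke : (3 * k <= e)%N by have := ltn_ord k; have := odd_p; rewrite /e; lia.
rewrite hornerZ /cubic_term !hornerM !horner_exp hornerX h2 h8 /coef6 !natrM.
(* The prefactor absorbs the denominator (3 t + 5)^(3 k), leaving the power in [cubic_term]. *)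
have -> : (3 * t + 5) ^+ e = ((3 * t + 5) ^+ 3) ^+ k * (3 * t + 5) ^+ (e - 3 * k).
  by rewrite -exprM -exprD subnKC.
rewrite exprM expr_div_n !exprMn; move: (_ ^+ (e - _)) => a.
have nz1 : 64 ^+ k != 0 :> F by rewrite expf_neq0.
by field; rewrite nz1 expf_neq0.
Qed.
End CharP.

(** * Euler's criterion, and reduction of p-integral rationals to F_p *)

Section Reduction.
Variable p : nat.
Hypotheses (p_prime : prime p) (p_gt3 : (3 < p)%N).
Local Notation F := 'F_p.

Let p_char : p \in [pchar F] := pchar_Fp p_prime.

Lemma intr_eq0_Fp (n : int) : (n%:~R == 0 :> F) = (p %| n)%Z.
Proof.
rewrite dvdzE [in LHS](intEsign n) rmorphM rmorph_sign mulf_eq0 signr_eq0 /=.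
by rewrite -pmulrn (natr_eq0_pchar p_char).
Qed.

Lemma intr_eq_Fp (m n : int) : (m%:~R == n%:~R :> F) = (m == n %[mod p])%Z.
Proof. by rewrite -subr_eq0 -rmorphB intr_eq0_Fp eqz_mod_dvd. Qed.

(** For a nonresidue, a^e is a square root of 1. Were it 1, then a and the squares of 1, ..., e
    would be e + 1 distinct roots of X^e - 1. *)
Lemma euler_criterion (n : int) : (legendre p n)%:~R = n%:~R ^+ (p.-1 %/ 2) :> F.
Proof.
set e := (p.-1 %/ 2)%N; have pE : (2 * e + 1 = p)%N := half_pred p_prime p_gt3.
have e_gt0 : (0 < e)%N by rewrite /e; lia.
set a : F := n%:~R; rewrite /legendre -intr_eq0_Fp -/a.
have [->|a0] := eqVneq a 0; first by rewrite expr0n gtn_eqF.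
have fermat (b : F) : b != 0 -> (b ^+ 2) ^+ e = 1.
  move=> b0; apply: (mulfI b0); rewrite mulr1 -exprM -exprS -addn1 pE.
  by rewrite -[in X in _ ^+ X](card_Fp p_prime) expf_card.
case: existsP => [[x]|nonsq].
  rewrite -intr_eq_Fp rmorphXn /= => /eqP xa; rewrite -/a in xa.
  by rewrite -xa fermat //; apply: contraNneq a0 => x0; rewrite -xa x0 expr0n.
have : (a ^+ e) ^+ 2 == 1 by rewrite -exprM mulnC exprM fermat.
rewrite sqrf_eq1 => /orP[/eqP ae1|/eqP -> //].
pose squares : seq F := [seq (i%:R : F) ^+ 2 | i <- iota 1 e].
have roots : all (root ('X^e - 1)) (a :: squares).
  rewrite /= rootE !hornerE ae1 subrr eqxx /=.
  apply/allP => x /mapP[i]; rewrite mem_iota => /andP[i1 ie] {x}->.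
  rewrite rootE !hornerE fermat ?subrr // (natr_eq0_pchar p_char).
  by rewrite gtnNdvd //; lia.
have uniq_squares : uniq (a :: squares).
  rewrite cons_uniq; apply/andP; split.
    apply/mapP => -[i]; rewrite mem_iota => /andP[i1 ie] aE; apply: nonsq.
    have ip : (i < p)%N by lia.
    by exists (Ordinal ip); rewrite -intr_eq_Fp rmorphXn /= -/a aE.
  rewrite /squares map_inj_in_uniq ?iota_uniq // => i j.
  wlog ij : i j / (i <= j)%N.
    move=> H Hi Hj E; case: (leqP i j) => [ij|/ltnW ji]; first exact: H.
    by apply/esym/H.
  rewrite !mem_iota => /andP[i1 ie] /andP[j1 je] /eqP.
  rewrite eq_sym eqf_sqr => /orP[]; rewrite -subr_eq0 ?opprK -?natrD -?natrB //.
    (* For 1 <= i <= j <= e both j - i and j + i are below p, so p divides one of them only if i =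
       j. *)
    by rewrite (natr_eq0_pchar p_char) => /dvdnP[[|q]]; nia.
  by rewrite (natr_eq0_pchar p_char) => /dvdnP[[|q]]; nia.
have nz : 'X^e - 1 != 0 :> {poly F} by rewrite -size_poly_eq0 size_Xn_sub_1.
have := max_poly_roots nz roots uniq_squares.
by rewrite size_Xn_sub_1 //= size_map size_iota ltnn.
Qed.

(** [ratr] divides numerator by denominator in F_p, which is a ring morphism only on [Zloc p]. The
    relational form lets reductions be built along an expression. *)
Definition reduces (x : rat) (a : F) : Prop := x \in Zloc p /\ ratr x = a.

(** Any fraction m / d with d prime to p computes the reduction, not only the one in lowest
    terms. *)
Lemma reduces_frac (x : rat) (m d : int) (a : F) :
  d%:~R != 0 :> F -> x * d%:~R = m%:~R -> a * d%:~R = m%:~R -> reduces x a.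
Proof.
move=> d0 xd ad; have xZ : x \in Zloc p by apply: Zloc_intro xd; rewrite -intr_eq0_Fp.
split=> //; have nz : (denq x)%:~R != 0 :> F by rewrite intr_eq0_Fp.
rewrite /ratr; apply: (mulIf d0); rewrite ad mulrAC; apply: (mulIf nz).
rewrite divfK // -!rmorphM /=; congr (_%:~R); apply: (@intr_inj rat).
by rewrite !rmorphM /= numqE -xd; ring.
Qed.

Lemma reducesP (x : rat) (a : F) : reduces x a ->
  exists m d : int, [/\ d%:~R != 0 :> F, x * d%:~R = m%:~R & a * d%:~R = m%:~R].
Proof.
case=> xZ <-; exists (numq x), (denq x).
have nz : (denq x)%:~R != 0 :> F by rewrite intr_eq0_Fp.
by split=> //; [rewrite numqE | rewrite /ratr divfK].
Qed.

Lemma reduces_int (n : int) : reduces n%:~R n%:~R.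
Proof. by apply: (@reduces_frac _ n 1); rewrite ?mulr1 ?oner_neq0. Qed.

Lemma reduces_nat (n : nat) : reduces n%:R n%:R.
Proof. exact: reduces_int n. Qed.

Lemma reducesD x y a b : reduces x a -> reduces y b -> reduces (x + y) (a + b).
Proof.
move=> /reducesP[m [d [d0 xd ad]]] /reducesP[n [f [f0 yf bf]]].
apply: (@reduces_frac _ (m * f + n * d) (d * f)); rewrite ?rmorphM ?rmorphD ?rmorphM /=.
- by rewrite mulf_neq0.
- by rewrite -xd -yf; ring.
- by rewrite -ad -bf; ring.
Qed.

Lemma reducesM x y a b : reduces x a -> reduces y b -> reduces (x * y) (a * b).
Proof.
move=> /reducesP[m [d [d0 xd ad]]] /reducesP[n [f [f0 yf bf]]].
apply: (@reduces_frac _ (m * n) (d * f)); rewrite ?rmorphM /=.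
- by rewrite mulf_neq0.
- by rewrite -xd -yf; ring.
- by rewrite -ad -bf; ring.
Qed.

Lemma reducesN x a : reduces x a -> reduces (- x) (- a).
Proof.
by move=> xa; rewrite -mulN1r -[- a]mulN1r; apply: reducesM xa; apply: (reduces_int (-1)).
Qed.

Lemma reducesV x a : a != 0 -> reduces x a -> reduces x^-1 a^-1.
Proof.
move=> a0 /reducesP[m [d [d0 xd ad]]].
have m0 : m%:~R != 0 :> F by rewrite -ad mulf_neq0.
have x0 : x != 0.
  apply: contraNneq m0 => x0; move: xd; rewrite x0 mul0r => /esym/eqP.
  by rewrite intr_eq0 => /eqP ->.
by apply: (@reduces_frac _ d m); rewrite // -?xd -?ad mulKf.
Qed.

Lemma reducesX x a n : reduces x a -> reduces (x ^+ n) (a ^+ n).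
Proof.
move=> xa; elim: n => [|n IH]; first exact: (reduces_nat 1).
by rewrite !exprS; apply: reducesM.
Qed.

Lemma reduces_sum n (x : 'I_n -> rat) (a : 'I_n -> F) :
  (forall k, reduces (x k) (a k)) -> reduces (\sum_(k < n) x k) (\sum_(k < n) a k).
Proof.
move=> xa; apply: big_ind2; [exact: (reduces_nat 0) | | by []].
by move=> *; apply: reducesD.
Qed.

(** The difference x - y = m / d reduces to 0, so m = q p and (x - y) / p = q / d. *)
Lemma reduces_eqmod x y a : reduces x a -> reduces y a -> eqmodZloc p x y.
Proof.
move=> xa ya; rewrite /eqmodZloc xa.1 ya.1 /=.
have /reducesP[m [d [d0 xd]]] := reducesD xa (reducesN ya).
rewrite subrr mul0r => /esym/eqP; rewrite intr_eq0_Fp => /dvdzP[q mE].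
apply: (@Zloc_intro _ _ d q); first by rewrite -intr_eq0_Fp.
have p0 : p%:R != 0 :> rat by rewrite pnatr_eq0 -lt0n prime_gt0.
by rewrite mulrAC xd mE rmorphM /= -pmulrn mulfK.
Qed.

Lemma reduces_legendre x a :
  reduces x a -> reduces (legendre_loc p x)%:~R (a ^+ (p.-1 %/ 2)).
Proof.
(* Read as a natural number, a is itself the integer representative that [legendre_locE] asks
   for. *)
move=> xa; have aE : (a : nat)%:~R = a :> F by rewrite -pmulrn natr_Zp.
rewrite (@legendre_locE p x (a : nat)) //; last first.
  by apply: reduces_eqmod xa _; rewrite -[X in reduces _ X]aE; apply: reduces_int.
by rewrite -[X in X ^+ _]aE -euler_criterion; apply: reduces_int.
Qed.
End Reduction.
Arguments reduces : clear implicits.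

(** * The congruences, from the identity over F_p at t and at - t *)

Theorem theorem2p3 (p : nat) (t : rat) (p_prime : prime p) (p_gt3 : (3 < p)%N)
    (tZ : t \in Zloc p)
    (t_neq5 : ~~ eqmodZloc p (3%:R * t) 5%:R)
    (t_neqN5 : ~~ eqmodZloc p (3%:R * t) (- 5%:R)) :
  let S1 : rat :=
    \sum_(k < (p.-1 %/ 2).+1)
      'C(2 * k, k)%:R ^+ 2 * 'C(4 * k, 2 * k)%:R
        * ((1 - t ^+ 2) / 256%:R) ^+ k in
  let S2 : rat :=
    \sum_(k < (p %/ 6).+1)
      'C(2 * k, k)%:R * 'C(3 * k, k)%:R * 'C(6 * k, 3 * k)%:R
        * ((t - 1) ^+ 2 * (t + 1) / (64%:R * (3%:R * t + 5%:R) ^+ 3)) ^+ k in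
  let S3 : rat :=
    \sum_(k < (p %/ 6).+1)
      'C(2 * k, k)%:R * 'C(3 * k, k)%:R * 'C(6 * k, 3 * k)%:R
        * ((t + 1) ^+ 2 * (t - 1) / (64%:R * (3%:R * t - 5%:R) ^+ 3)) ^+ k in
  eqmodZloc p S1 ((legendre_loc p (10%:R + 6%:R * t))%:~R * S2)
  /\ eqmodZloc p ((legendre_loc p (10%:R + 6%:R * t))%:~R * S2)
               ((legendre_loc p (10%:R - 6%:R * t))%:~R * S3).
Proof.
move=> S1 S2 S3.
have nz2 : 2 != 0 :> 'F_p by apply: two_neq0 p_gt3 (pchar_Fp p_prime).
have nz64 : 64 != 0 :> 'F_p by rewrite (natrX _ 2 6) expf_neq0.
have nz256 : 256 != 0 :> 'F_p by rewrite (natrX _ 2 8) expf_neq0.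
set a : 'F_p := ratr t; have ta : reduces p t a by split.
have natR := reduces_nat p_prime; have addR := reducesD p_prime.
have mulR := reducesM p_prime; have oppR := reducesN p_prime.
have expR := reducesX p_prime; have invR := reducesV p_prime.
have nzp : 3 * a + 5 != 0.
  apply: contra t_neqN5; rewrite addr_eq0 => /eqP a5.
  apply: (reduces_eqmod p_prime (mulR _ _ _ _ (natR 3) ta)).
  by rewrite a5; apply: (oppR).
have nzm : 3 * a - 5 != 0.
  apply: contra t_neq5; rewrite subr_eq0 => /eqP a5.
  by apply: (reduces_eqmod p_prime (mulR _ _ _ _ (natR 3) ta)); rewrite a5.
(* All three expressions are shown to reduce to this value. *)
pose s : 'F_p := \sum_(k < (p.-1 %/ 2).+1)
  'C(2 * k, k)%:R ^+ 2 * 'C(4 * k, 2 * k)%:R * ((1 - a ^+ 2) / 256) ^+ k.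
have r1 : reduces p S1 s.
  apply: (reduces_sum p_prime) => k.
  apply: (mulR); first by apply: (mulR); [apply: (expR)|].
  apply/expR/mulR; last exact: invR.
  by apply: (addR) (natR 1) _; apply/oppR/expR.
have r2 : reduces p ((legendre_loc p (10 + 6 * t))%:~R * S2) s.
  rewrite /s (quad_cubic_transform p_prime p_gt3 (pchar_Fp p_prime) nzp).
  apply: (mulR); first by apply/reduces_legendre => //; apply/addR/mulR.
  apply: (reduces_sum p_prime) => k.
  apply: (mulR); first by apply: (mulR) => //; apply: (mulR).
  apply/expR/mulR.
    apply: (mulR); last exact: addR (natR 1).
    by apply/expR/addR/oppR/(natR 1).
  apply: (invR); first by rewrite mulf_neq0 ?expf_neq0.
  by apply/mulR/expR/addR => //; apply: (mulR).
have r3 : reduces p ((legendre_loc p (10 - 6 * t))%:~R * S3) s.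
  (* The transformation is applied at - a, which leaves s unchanged since only a^2 enters it. *)
  have nzm' : 3 * (- a) + 5 != 0 by rewrite -oppr_eq0 mulrN opprD opprK.
  have := quad_cubic_transform p_prime p_gt3 (pchar_Fp p_prime) nzm'.
  rewrite sqrrN => sE; rewrite /s sE mulrN.
  apply: (mulR); first by apply/reduces_legendre => //; apply/addR/oppR/mulR.
  apply: (reduces_sum p_prime) => k.
  apply: (mulR); first by apply: (mulR) => //; apply: (mulR).
  (* Replacing a by - a changes the sign of both a + 1 and the cube once rewritten through a - 1 and
     3 a - 5, so the signs cancel. *)
  apply: (expR); rewrite (_ : _ / _ = (a + 1) ^+ 2 * (a - 1) / (64 * (3 * a - 5) ^+ 3)).
    apply: (mulR).
      apply: (mulR); last exact: addR (oppR _ _ (natR 1)).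
      by apply/expR/addR/(natR 1).
    apply: (invR); first by rewrite mulf_neq0 ?expf_neq0.
    by apply/mulR/expR/addR/oppR => //; apply: (mulR).
  have -> : 3 * - a + 5 = - (3 * a - 5) by ring.
  by field; rewrite nz64 nzm oppr_eq0.
split; first exact: reduces_eqmod r1 r2.
exact: reduces_eqmod r2 r3.
Qed.
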